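(* Let $\mu$ be a Markov measure on $X^{\mathbb N}$ defined by an irreducible stochastic matrix $L$ with stationary probability vector $\boldsymbol{l}$. Suppose $g:X^{\mathbb N}\to X^{\mathbb N}$ is an invertible transformation generated by a reversible, $L$-strongly connected automaton $\mathcal A=(X,S,\pi,\lambda)$ with initial state $g\in S$. Then the measures $\mu$ and $g_*\mu$ are singular unless $\boldsymbol{l}_{\lambda(g,x)}=\boldsymbol{l}_x$ and $L_{\lambda(s,x),\,\lambda(\pi(s,x),y)}=L_{x,y}$ for all $s\in S$ and $x,y\in X$, in which case $g_*\mu=\mu$.
   Context: $X$ is a finite set (alphabet) with more than one element, $X^*$ the set of finite words over $X$ (including the empty word), $X^{\mathbb N}$ the set of infinite sequences over $X$ with the product topology; $wX^{\mathbb N}$ is the set of sequences with prefix $w$. The Markov measure defined by a stochastic matrix $L=(L_{xy})_{x,y\in X}$ with stationary probability vector $\boldsymbol{l}$ ($\boldsymbol{l}L=\boldsymbol{l}$) is the Borel probability measure with $\mu(x_1\ldots x_nX^{\mathbb N})=\boldsymbol{l}_{x_1}L_{x_1x_2}\cdots L_{x_{n-1}x_n}$. Pushforward: $g_*\mu(E)=\mu(g^{-1}(E))$. Two measures are singular if they are concentrated on disjoint Borel sets. An automaton $\mathcal A=(X,S,\pi,\lambda)$ consists of the alphabet $X$, a nonempty finite set $S$ of states, a transition function $\pi:S\times X\to S$ and an output function $\lambda:S\times X\to X$. The transition function is extended to words by $\pi(s,\varnothing)=s$, $\pi(s,xw)=\pi(\pi(s,x),w)$. Each state $s$ acts on $X^{\mathbb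 N}$ by $\omega_1\omega_2\ldots\mapsto\lambda(s_0,\omega_1)\lambda(s_1,\omega_2)\ldots$, where $s_0=s$ and $s_n=\pi(s_{n-1},\omega_n)$. A transformation is generated by $\mathcal A$ if it is the action of some (initial) state of $\mathcal A$; the transformation and the state are denoted by the same symbol $g$. $\mathcal A$ is reversible if for any $s\in S$ and $x\in X$ there exists a unique $s_0\in S$ with $\pi(s_0,x)=s$. $\mathcal A$ is $L$-strongly connected if for any states $s,r\in S$ and any symbols $x,y\in X$ there is a word $w=w_1\ldots w_n\in X^*$ (possibly empty) such that $\pi(s,xw)=r$ and all transitions between consecutive letters of the word $xwy$ have nonzero probability, i.e. $L_{xw_1},L_{w_1w_2},\dots,L_{w_{n-1}w_n},L_{w_ny}$ are all nonzero ($L_{xy}\ne0$ if $w$ is empty). *)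

(* Defs.v *)
From HB Require Import structures.
From mathcomp Require Export all_boot all_order all_algebra.
From mathcomp Require Export all_classical all_reals all_analysis.

Set Implicit Arguments.
Unset Strict Implicit.
Unset Printing Implicit Defensive.

Import Order.TTheory GRing.Theory Num.Theory.

Local Open Scope classical_set_scope.
Local Open Scope ring_scope.

(* The hypothesis X_gt1 is a parameter of the type because the library's
   measurable spaces are pointed: it provides the base point. *)
Definition infseq (X : finType) (X_gt1 : (1 < #|X|)%N) : Type :=
  prod_topology (fun _ : nat => discrete_topology X).

HB.instance Definition _ (X : finType) (X_gt1 : (1 < #|X|)%N) :=
  Topological.copy (infseq X_gt1)
    (prod_topology (fun _ : nat => discrete_topology X)).

HB.instance Definition _ (X : finType) (X_gt1 : (1 < #|X|)%N) :=
  isPointed.Build (infseq X_gt1)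
    (fun _ : nat => enum_val (Ordinal (ltnW X_gt1)) : X).

Notation borel_infseq X_gt1 := (g_sigma_algebraType (@open (infseq X_gt1))).

Definition cylinder (X : finType) (w : seq X) : set (nat -> X) :=
  [set omega | mkseq omega (size w) = w].

Section Markov.
Context {R : realType} {X : finType}.
Implicit Types (L : X -> X -> R) (l : X -> R).

Definition stochastic L : Prop :=
  (forall x y, 0 <= L x y) /\ (forall x, \sum_(y : X) L x y = 1).

Definition probability_vector l : Prop :=
  (forall x, 0 <= l x) /\ \sum_(x : X) l x = 1.

Definition stationary L l : Prop :=
  forall y, \sum_(x : X) l x * L x y = l y.

Definition matrix_of L : 'M[R]_#|X| :=
  \matrix_(i, j) L (enum_val i) (enum_val j).

Definition irreducible_matrix L : Prop :=
  forall x y, exists n : nat,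
    (0 < n)%N /\ 0 < (matrix_of L ^+ n) (enum_rank x) (enum_rank y).

Fixpoint transition_weight L (x : X) (w : seq X) : R :=
  if w is y :: w' then L x y * transition_weight L y w' else 1.

Definition markov_measure (X_gt1 : (1 < #|X|)%N) L l
    (mu : probability (borel_infseq X_gt1) R) : Prop :=
  forall (x : X) (w : seq X),
    mu (cylinder (x :: w)) = (l x * transition_weight L x w)%:E.

End Markov.

Definition singular d (T : measurableType d) (R : realType)
    (m1 m2 : set T -> \bar R) : Prop :=
  exists A B : set T,
    [/\ measurable A, measurable B, A `&` B = set0,
        m1 (~` A) = 0%E & m2 (~` B) = 0%E].

Record automaton (X : finType) := Automaton {
  state : finType;
  trans : state -> X -> state;
  output : state -> X -> X }.

Section Automaton.
Context {X : finType} (A : automaton X).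

Definition trans_word (s : state A) (w : seq X) : state A :=
  foldl (@trans X A) s w.

Fixpoint state_at (s : state A) (omega : nat -> X) (n : nat) : state A :=
  if n is n'.+1 then trans (state_at s omega n') (omega n') else s.

Definition action (s : state A) (omega : nat -> X) : nat -> X :=
  fun n => output (state_at s omega n) (omega n).

Definition reversible : Prop :=
  forall (s : state A) (x : X), exists! s0 : state A, trans s0 x = s.

Definition L_strongly_connected {R : realType} (L : X -> X -> R) : Prop :=
  forall (s r : state A) (x y : X), exists w : seq X,
    trans_word s (x :: w) = r /\ path (fun a b => L a b != 0) x (rcons w y).

Definition preserves_weights {R : realType} (L : X -> X -> R) (l : X -> R)
    (g : state A) : Prop :=
  (forall x : X, l (output g x) = l x) /\
  (forall (s : state A) (x y : X),
     L (output s x) (output (trans s x) y) = L x y).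

End Automaton.

(* Main.v *)
Require Import Defs.
From mathcomp Require Import ring.

Set Implicit Arguments.
Unset Strict Implicit.
Unset Printing Implicit Defensive.

Import Order.TTheory GRing.Theory Num.Theory.

Local Open Scope classical_set_scope.
Local Open Scope ring_scope.

(** The proof compares [mu] and [g_mu] on cylinders of length [n + 1] through
    the Hellinger sum of [sqrt (mu (cylinder w) * mu (cylinder (g w)))] over
    the words [w] of that length.  If these sums are arbitrarily small, then
    for every [e] some clopen set has [mu]-measure at most [e] while its
    complement has [g_mu]-measure at most [e] ([hellinger_separation]), and by
    Borel-Cantelli the two measures are singular ([singular_of_small]).

    Since [g] is invertible, every reachable state, hence by strong
    connectivity every state, permutes the alphabet ([invertible_output_inj]).
    The Hellinger sum is therefore governed by a nonnegative matrix indexed by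
    the pairs (state, letter), with entry [sqrt (L x y * L x' y')] on the step
    from [(s, x)] to [(trans s x, y)], where [x'], [y'] are the letters output
    along this step.  By the inequality between the geometric and arithmetic
    means its row sums are at most 1, and less than 1 in a row where some
    weight [L x y] is not preserved.  Strong connectivity propagates this
    deficit to all rows, so the powers of the matrix tend to 0
    ([affinity_cvg0]).

    Suppose next that all the weights [L x y] are preserved.  Summing the
    image of [l] over all the states gives a vector that reversibility makes
    stationary for [L], so it is a multiple of [l].  Hence [l] is an average
    of rearrangements of itself, which by convexity forces
    [l (output s x) = l x] for all [s] and [x] ([stationary_output]).  Thus if
    the weights are not all preserved, the failure already occurs in [L], and
    the measures are singular.  If they are all preserved, the two measures
    agree on cylinders, hence on Borel sets ([cylinder_measure_eq]). *)

(** * Cylinders and the topology of the space of sequences *)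

Lemma mkseq_recl (T : Type) (f : nat -> T) n :
  mkseq f n.+1 = f 0 :: mkseq (f \o S) n.
Proof. by rewrite /mkseq /= -[1%N]addn0 iotaDl -map_comp. Qed.

Lemma cylinder_mkseq (X : finType) (omega eta : nat -> X) n :
  cylinder (mkseq omega n) eta <-> mkseq eta n = mkseq omega n.
Proof. by rewrite /cylinder /= size_mkseq. Qed.

Section CylinderTopology.
Context {X : finType} (X_gt1 : (1 < #|X|)%N).
Let T := infseq X_gt1.

Lemma open_coord (n : nat) (x : X) : open ([set omega | omega n = x] : set T).
Proof.
rewrite (_ : [set _ | _] = proj n @^-1` [set x]) //.
apply: (@open_comp T (discrete_topology X)); last exact: discrete_open.
by move=> omega _; exact: (@proj_continuous nat (fun=> discrete_topology X)).
Qed.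

Lemma open_cylinder (w : seq X) : open (cylinder w : set T).
Proof.
(* The prefixes of w are handled by induction on their length n; the statement
   also covers n > size w, where the set is empty. *)
suff H n : open ([set omega | mkseq omega n = take n w] : set T).
  by have := H (size w); rewrite take_size.
elim: n => [|n IH]; first by rewrite [X in open X](_ : _ = setT) ?take0//;
  [exact: openT|apply/seteqP; split].
have [nw|nw] := ltnP n (size w); last first.
  rewrite [X in open X](_ : _ = set0); first exact: open0.
  apply/seteqP; split => // omega /= /(congr1 size).
  by rewrite size_mkseq take_oversize ?leqW// => nE; rewrite -nE ltnn in nw.
have x0 : X by case: w nw {IH}.
rewrite [X in open X](_ : _ = [set omega | mkseq omega n = take n w] `&`
  [set omega | omega n = nth x0 w n]).
  by apply: openI => //; exact: open_coord.
apply/seteqP; split => omega /=; rewrite (take_nth x0 nw) mkseqS.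
  by move=> /rcons_inj[-> ->].
by move=> [-> ->].
Qed.

(** Cylinders form a basis: finitely many coordinates are all controlled by a
    long enough prefix. This is the form in which the product topology is used
    from here on. *)
Lemma open_cylinderP (U : set T) :
  open U <-> forall omega, U omega -> exists n, cylinder (mkseq omega n) `<=` U.
Proof.
split=> [oU omega Uo|H].
  pose F := filter_from [set: nat] (fun n => cylinder (mkseq omega n) : set T).
  have FF : Filter F.
    apply: filter_from_filter; first by exists 0%N.
    move=> i j _ _; exists (maxn i j) => // eta /cylinder_mkseq e.
    have sub k : (k <= maxn i j)%N -> mkseq eta k = mkseq omega k.
      move=> le; have := congr1 (take k) e.
      by rewrite /mkseq -!map_take take_iota (minn_idPl le).
    by split; apply/cylinder_mkseq; apply: sub; rewrite ?leq_maxl ?leq_maxr.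
  have : F --> (omega : T).
    apply/cvg_sup => i V [B [[C _ <-] Ci BV]].
    exists i.+1 => // eta /cylinder_mkseq; rewrite !mkseqS => /rcons_inj[_ e].
    by apply: BV; rewrite /= e.
  by move=> /(_ U (open_nbhs_nbhs (conj oU Uo)))[n _ nU]; exists n.
rewrite openE => omega /H[n nU]; rewrite /interior /=.
apply: filterS nU _; apply: open_nbhs_nbhs; split; first exact: open_cylinder.
by apply/cylinder_mkseq.
Qed.
End CylinderTopology.

(** * Words and the action of the automaton *)

Section Words.
Context {X : finType}.

Definition words (n : nat) : seq (seq X) :=
  iter n (fun ws => [seq x :: w | x <- enum X, w <- ws]) [:: [::]].

Lemma mkseq_words (omega : nat -> X) n : mkseq omega n \in words n.
Proof.
elim: n omega => [|n IH] omega //; rewrite mkseq_recl /words iterS.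
by apply: allpairs_f; [exact: mem_enum|exact: IH].
Qed.

Lemma sum_words (V : nmodType) n (F : seq X -> V) :
  \sum_(w <- words n.+1) F w = \sum_x \sum_(w <- words n) F (x :: w).
Proof. by rewrite /words iterS big_allpairs_dep big_enum. Qed.
End Words.

Section Output.
Context {X : finType} {A : automaton X}.
Implicit Types (s g : state A) (w : seq X).

Fixpoint output_word s w : seq X :=
  if w is x :: w' then output s x :: output_word (trans s x) w' else [::].

Lemma action_shift s omega :
  action s omega \o S = action (trans s (omega 0)) (omega \o S).
Proof.
apply/funext => n; rewrite /action /=; congr output.
by elim: n => //= n ->.
Qed.

Lemma mkseq_action s omega n :
  mkseq (action s omega) n = output_word s (mkseq omega n).
Proof.
elim: n s omega => // n IH s omega.
by rewrite !mkseq_recl /= action_shift IH.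
Qed.

Lemma output_word_inj s w w' : (forall r, injective (@output X A r)) ->
  size w = size w' -> output_word s w = output_word s w' -> w = w'.
Proof.
move=> oi; elim: w w' s => [|x w IH] [|y w'] s //= [sz] [/oi <-] /IH.
by move=> ->.
Qed.

Lemma output_word_surj s w : (forall r, injective (@output X A r)) ->
  exists w', size w' = size w /\ output_word s w' = w.
Proof.
move=> oi; elim: w s => [|y w IH] s; first by exists [::].
have [f _ fK] := injF_bij (oi s).
have [w' [sz ow]] := IH (trans s (f y)); exists (f y :: w').
by rewrite /= sz ow fK.
Qed.

(** The first letter of the image depends only on the first letter of the
    argument, and a surjection of the finite alphabet is injective. *)
Lemma surjective_output s :
  (forall eta, exists omega, action s omega = eta) ->
  injective (@output X A s).
Proof.
move=> su.
have sj y : exists x, output s x = y.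
  have [omega /(congr1 (@^~ 0%N)) e] := su (fun=> y).
  by exists (omega 0%N).
have [f fK] := choice sj.
by apply: (can_inj (g := f)); exact: (canF_sym fK).
Qed.

(** Surjectivity passes to the next state: a preimage of [output s x] followed
    by [eta] has to begin with [x], and its tail is a preimage of [eta]. *)
Lemma surjective_section s x : injective (@output X A s) ->
  (forall eta, exists omega, action s omega = eta) ->
  (forall eta, exists omega, action (trans s x) omega = eta).
Proof.
move=> oi su eta.
have [omega e] := su (fun n => if n is n'.+1 then eta n' else output s x).
exists (omega \o S); have /oi <- : output s (omega 0%N) = output s x.
  by have := congr1 (@^~ 0%N) e.
by rewrite -action_shift e.
Qed.

(** Invertibility is assumed for the initial state only; strong connectivity
    enters because it makes every state reachable from [g]. *)
Lemma invertible_output_inj (R : realType) (L : X -> X -> R) g :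
  bijective (action g) -> L_strongly_connected A L ->
  forall s, injective (@output X A s).
Proof.
move=> [f _ fK] sc s x y.
have su w (r : state A) :
    (forall eta, exists omega, action r omega = eta) ->
  (forall eta, exists omega, action (trans_word r w) omega = eta).
  elim: w r => //= z w IH r sr; apply: (IH (trans r z)).
  apply: (surjective_section z _ sr).
  exact: surjective_output sr.
have [w [<- _]] := sc g s x x.
apply: surjective_output.
by apply: su => eta; exists (f eta); exact: fK.
Qed.
End Output.

(** * Decay of the Hellinger affinity *)

(** The exact deficit in the inequality between geometric and arithmetic means:
    it gives both the upper bound on a row sum and its strictness. *)
Lemma sum_sqrtM (R : rcfType) (I : finType) (a b : I -> R) :
  (forall i, 0 <= a i) -> (forall i, 0 <= b i) ->
  \sum_i Num.sqrt (a i * b i) =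
  (\sum_i a i + \sum_i b i - \sum_i (Num.sqrt (a i) - Num.sqrt (b i)) ^+ 2) / 2.
Proof.
move=> a0 b0; rewrite -big_split -sumrB /= mulr_suml; apply: eq_bigr => i _.
rewrite sqrtrM//.
have := sqr_sqrtr (a0 i); have := sqr_sqrtr (b0 i).
move: (Num.sqrt _) (Num.sqrt _) => x y <- <-; by field.
Qed.

Section Affinity.
Context {R : realType} {X : finType} {A : automaton X}.
Variable L : X -> X -> R.
Implicit Type s : state A.
Hypothesis Lst : stochastic L.
Hypothesis oi : forall s, injective (@output X A s).

Definition edge_affinity s x y :=
  Num.sqrt (L x y * L (output s x) (output (trans s x) y)).

(** The n-th power of the matrix with entries [edge_affinity], applied to the
    constant vector 1. *)
Fixpoint affinity n s x : R :=
  if n is n'.+1 then \sum_y edge_affinity s x y * affinity n' (trans s x) y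
  else 1.

Let L0 x y : 0 <= L x y. Proof. by case: Lst. Qed.

Lemma transition_weight_ge0 x w : 0 <= transition_weight L x w.
Proof. by elim: w x => //= y w IH x; rewrite mulr_ge0. Qed.

Lemma sum_sqrt_transition_weight n s x :
  \sum_(w <- words n) Num.sqrt (transition_weight L x w *
    transition_weight L (output s x) (output_word (trans s x) w)) =
  affinity n s x.
Proof.
elim: n s x => [|n IH] s x; first by rewrite big_seq1 /= mulr1 sqrtr1.
rewrite sum_words /=; apply: eq_bigr => y _; rewrite -IH mulr_sumr.
by apply: eq_bigr => w _; rewrite mulrACA sqrtrM// mulr_ge0.
Qed.

Lemma affinity_ge0 n s x : 0 <= affinity n s x.
Proof.
elim: n s x => //= n IH s x.
by apply: sumr_ge0 => y _; rewrite mulr_ge0 ?sqrtr_ge0.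
Qed.

Let sumL_output s x : \sum_y L x (output s y) = 1.
Proof. by have [_ /(_ x) <-] := Lst; rewrite [RHS](reindex_inj (@oi s)). Qed.

Lemma sum_edge_affinity s x : \sum_y edge_affinity s x y = 1 -
  (\sum_y (Num.sqrt (L x y) -
           Num.sqrt (L (output s x) (output (trans s x) y))) ^+ 2) / 2.
Proof.
by rewrite sum_sqrtM// sumL_output; have [_ ->] := Lst; by field.
Qed.

Lemma sum_edge_affinity_le1 s x : \sum_y edge_affinity s x y <= 1.
Proof.
rewrite sum_edge_affinity lerBlDr lerDl divr_ge0// sumr_ge0// => y _.
exact: sqr_ge0.
Qed.

Lemma sum_edge_affinity_lt1 s x y :
  L (output s x) (output (trans s x) y) != L x y ->
  \sum_y edge_affinity s x y < 1.
Proof.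
move=> ne; rewrite sum_edge_affinity ltrBlDr ltrDl divr_gt0//.
rewrite (bigD1 y)//= ltr_pwDl//; last by apply: sumr_ge0 => *; exact: sqr_ge0.
rewrite lt_neqAle sqr_ge0 andbT eq_sym sqrf_eq0 subr_eq0.
by rewrite eqr_sqrt// eq_sym.
Qed.

(** The powers of a nonnegative matrix are submultiplicative for the maximal
    row sum: with [c = 1] this is monotonicity, with [c < 1] geometric decay. *)
Lemma affinityD m n c : (forall s x, affinity m s x <= c) ->
  forall s x, affinity (n + m) s x <= affinity n s x * c.
Proof.
move=> mc; elim: n => [|n IH] s x; first by rewrite mul1r.
rewrite addSn /= mulr_suml ler_sum// => y _.
by rewrite -mulrA ler_wpM2l ?sqrtr_ge0.
Qed.

Lemma affinity_le1 n s x : affinity n s x <= 1.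
Proof.
elim: n s x => //= n IH s x; apply: le_trans (sum_edge_affinity_le1 s x).
by apply: ler_sum => y _; rewrite ler_piMr// ?sqrtr_ge0.
Qed.

Lemma affinity_le m n s x : (n <= m)%N -> affinity m s x <= affinity n s x.
Proof.
move=> /subnKC <-; rewrite -[leRHS]mulr1.
by apply: affinityD => r y; exact: affinity_le1.
Qed.

(** A deficit travels backwards along an edge of positive [L]-weight. Either
    the edge has positive affinity and transmits it, or its affinity vanishes
    although [L x y] does not, and the row of [(s, x)] has its own deficit. *)
Lemma affinity_lt1_step s x y : L x y != 0 ->
  (exists n, affinity n (trans s x) y < 1) -> exists n, affinity n s x < 1.
Proof.
move=> Lxy [n lt1].
have [q0|q0] := eqVneq (edge_affinity s x y) 0.
  exists 1%N => /=; under eq_bigr do rewrite mulr1.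
  apply: (@sum_edge_affinity_lt1 _ _ y); apply: contra_neq Lxy => e.
  move: q0 => /eqP; rewrite /edge_affinity e -expr2 sqrtr_sqr normr_eq0.
  by move=> /eqP.
exists n.+1 => /=; apply: lt_le_trans (sum_edge_affinity_le1 s x).
rewrite (bigD1 y)//= [ltRHS](bigD1 y)//= ltr_leD//; last first.
  by apply: ler_sum => z _; rewrite ler_piMr ?affinity_le1// sqrtr_ge0.
by rewrite gtr_pMr// lt_neqAle eq_sym q0 sqrtr_ge0.
Qed.

Lemma affinity_lt1 s0 x0 y0 : L_strongly_connected A L ->
  L (output s0 x0) (output (trans s0 x0) y0) != L x0 y0 ->
  forall s x, exists n, affinity n s x < 1.
Proof.
move=> sc ne s x; have [w [e p]] := sc s s0 x x0.
rewrite -{s0}e in ne; move: ne p.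
elim: w s x => [|y w IH] s x /= ne.
  rewrite andbT => Lx; apply: affinity_lt1_step Lx _; exists 1%N => /=.
  under eq_bigr do rewrite mulr1.
  exact: sum_edge_affinity_lt1 ne.
by move=> /andP[Lx p]; apply: affinity_lt1_step Lx _; exact: IH.
Qed.

(** There are finitely many pairs (state, letter), so a single power [N] has
    all its row sums below a constant [c < 1], and the affinities at [k * N]
    are at most [c ^+ k]. *)
Lemma affinity_cvg0 s0 x0 y0 : L_strongly_connected A L ->
  L (output s0 x0) (output (trans s0 x0) y0) != L x0 y0 ->
  forall e, 0 < e -> exists n, forall s x, affinity n s x <= e.
Proof.
move=> sc ne e e0.
have [N0 hN0] := choice (fun p : state A * X => affinity_lt1 sc ne p.1 p.2).
pose N := (\max_p N0 p)%N.
pose c := \big[Num.max/0]_(p : state A * X) affinity N p.1 p.2.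
have c0 : 0 <= c by exact: bigmax_ge_id.
have c1 : c < 1.
  apply: bigmax_lt => // p _; apply: le_lt_trans (hN0 p).
  by apply: affinity_le; exact: leq_bigmax.
have cN s x : affinity N s x <= c.
  exact: (@le_bigmax _ _ _ 0
    (fun p : state A * X => affinity N p.1 p.2) (s, x)).
have ck k s x : affinity (k * N) s x <= c ^+ k.
  elim: k => // k IH; rewrite mulSn addnC exprSr.
  by apply: le_trans (affinityD _ cN _ _) _; rewrite ler_wpM2r.
have /cvgrPdist_le/(_ e e0)[k _ /(_ k (leqnn k))] :
    (fun k => c ^+ k) @ \oo --> 0.
  by apply: cvg_expr; rewrite ger0_norm.
rewrite sub0r normrN ger0_norm ?exprn_ge0// => cke.
by exists (k * N)%N => s x; apply: le_trans (ck k s x) cke.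
Qed.
End Affinity.

(** * The stationary vector under a weight-preserving automaton *)

Section Stationary.
Context {R : realType} {X : finType}.
Variable L : X -> X -> R.
Hypothesis Lst : stochastic L.
Hypothesis Lconn : forall x y, exists w,
  path (fun a b => L a b != 0) x (rcons w y).

(** The mass at [y] is a sum of nonnegative inflows, so if it is 0 then so is
    the mass at every predecessor of [y]; connectivity does the rest. *)
Lemma stationary_eq0 (v : X -> R) y : (forall x, 0 <= v x) -> stationary L v ->
  v y = 0 -> forall x, v x = 0.
Proof.
move=> v0 vst vy x; have [w] := Lconn x y.
have step a b : L a b != 0 -> v b = 0 -> v a = 0.
  move=> Lab vb; have /eqP := vst b.
  rewrite vb psumr_eq0 => [/allP/(_ a (mem_index_enum _))/=|c _].
    by rewrite mulf_eq0 (negbTE Lab) orbF => /eqP.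
  by rewrite mulr_ge0//; case: Lst.
elim: w x => [|b w IH] a /=; first by rewrite andbT => /step; apply.
by move=> /andP[/step st /IH vb]; exact: st.
Qed.

(** Subtract from [v] the largest multiple of [l] that keeps it nonnegative:
    the difference is stationary and vanishes somewhere, hence everywhere. *)
Lemma stationary_unique (l v : X -> R) : probability_vector l ->
  stationary L l -> (forall x, 0 <= v x) -> stationary L v ->
  forall x, v x = (\sum_y v y) * l x.
Proof.
move=> [l0 l1] lst v0 vst.
have [x0 _|X0] := pickP (pred_of_simpl (@predT X)); last first.
  by move=> x; have := X0 x.
have lpos x : 0 < l x.
  rewrite lt_neqAle l0 andbT eq_sym; apply/eqP => lx.
  have := oner_neq0 R; rewrite -l1 big1 ?eqxx// => y _.
  exact: stationary_eq0 lx y.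
have [y _ ymin] := arg_minP (fun x => v x / l x) (erefl (predT x0)).
set c := v y / l y in ymin.
have e x : v x = c * l x.
  apply/eqP; rewrite -subr_eq0; apply/eqP; move: x.
  apply: (@stationary_eq0 (fun x => v x - c * l x) y).
  - by move=> x; rewrite subr_ge0 -ler_pdivlMr// ymin.
  - move=> z; rewrite -(vst z) -(lst z) mulr_sumr -sumrB.
    by apply: eq_bigr => x _; rewrite mulrBl mulrA.
  - by rewrite /c divfK ?subrr// gt_eqF.
move=> x; under eq_bigr do rewrite e.
by rewrite -mulr_sumr l1 mulr1 e.
Qed.

Context (A : automaton X).
Hypothesis oi : forall s : state A, injective (output s).
Hypothesis rev : reversible A.

Lemma reversible_bij x : bijective (fun s : state A => trans s x).
Proof.
apply: injF_bij => s s' e; have [r [_ u]] := rev (trans s x) x.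
by rewrite -(u s erefl) (u s' (esym e)).
Qed.

(** Let [k] be the sum over all states of the images of [l] under the output
    permutations. It is stationary, because for each fixed letter the
    transition permutes the states, so [k = #|state A| * l]. Expanding the sum
    of [(l (output s x) - l x) ^+ 2] over all [s] and [x] with this identity
    gives 0. *)
Lemma stationary_output (l : X -> R) : probability_vector l -> stationary L l ->
  (forall (s : state A) x y, L (output s x) (output (trans s x) y) = L x y) ->
  forall (s : state A) x, l (output s x) = l x.
Proof.
move=> lp lst Leq.
pose k b := \sum_(s : state A) \sum_(x | output s x == b) l x.
have sum_k (F : X -> R) : \sum_b k b * F b =
    \sum_(s : state A) \sum_x l x * F (output s x).
  transitivity (\sum_b \sum_(s : state A) \sum_(x | output s x == b) l x * F b).
    apply: eq_bigr => b _; rewrite mulr_suml.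
    by apply: eq_bigr => s _; rewrite mulr_suml.
  rewrite exchange_big /=; apply: eq_bigr => s _.
  rewrite [RHS](partition_big (output s) predT)//=; apply: eq_bigr => b _.
  by apply: eq_bigr => x /eqP ->.
have kst : stationary L k.
  move=> c; rewrite sum_k exchange_big /=.
  transitivity (\sum_x \sum_(s : state A)
                 \sum_(y | output s y == c) l x * L x y).
    apply: eq_bigr => x _; have [f fK Kf] := reversible_bij x.
    (* Reversibility: the sum over the states may be taken over trans s x. *)
    rewrite [RHS](reindex (fun s : state A => trans s x)) /=; last first.
      by exists f => s _; [exact: fK|exact: Kf].
    apply: eq_bigr => s _; have [h hK Kh] := injF_bij (@oi (trans s x)).
    rewrite (big_pred1 (h c)) => [|y]; last by rewrite (can2_eq hK Kh).
    by rewrite -{1}(Kh c) Leq.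
  rewrite exchange_big /=; apply: eq_bigr => s _.
  by rewrite exchange_big /=; apply: eq_bigr => y _; rewrite lst.
have k0 b : 0 <= k b.
  by apply: sumr_ge0 => s _; apply: sumr_ge0 => x _; case: lp.
have sumC (a : R) : \sum_(s : state A) a = #|state A|%:R * a.
  by rewrite sumr_const mulr_natl.
have kE b : k b = #|state A|%:R * l b.
  rewrite (stationary_unique lp lst k0 kst); congr (_ * _).
  have := sum_k (fun=> 1); under eq_bigr do rewrite mulr1.
  move=> ->; under eq_bigr do under eq_bigr do rewrite mulr1.
  by case: lp => _ ->; rewrite sumC mulr1.
have sq : \sum_(s : state A) \sum_x (l (output s x) - l x) ^+ 2 = 0.
  transitivity (\sum_(s : state A) (\sum_x l x ^+ 2 + \sum_x l x ^+ 2
                 - \sum_x l x * (l (output s x) *+ 2))).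
    apply: eq_bigr => s _.
    rewrite [X in _ = X + _ - _](reindex_inj (@oi s)) /= -big_split -sumrB.
    by apply: eq_bigr => x _ /=; ring.
  rewrite sumrB sumC -(sum_k (fun b => l b *+ 2)).
  have -> : \sum_b k b * (l b *+ 2) = #|state A|%:R * (\sum_b l b ^+ 2) *+ 2.
    rewrite mulr_sumr -sumrMnl; apply: eq_bigr => b _.
    by rewrite kE; ring.
  by ring.
move=> s x; move/eqP: sq; rewrite psumr_eq0; last first.
  by move=> r _; apply: sumr_ge0 => y _; exact: sqr_ge0.
move=> /allP/(_ s (mem_index_enum _))/=; rewrite psumr_eq0; last first.
  by move=> y _; exact: sqr_ge0.
move=> /allP/(_ x (mem_index_enum _))/=; rewrite sqrf_eq0 subr_eq0.
by move=> /eqP.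
Qed.
End Stationary.

(** * Singularity and equality of measures *)

Section Measures.
Context d (T : measurableType d) (R : realType).

Lemma measure_bigsetU_le (m : {measure set T -> \bar R}) (I : Type)
    (s : seq I) (P : pred I) (F : I -> set T) :
  (forall i, measurable (F i)) ->
  (m (\big[setU/set0]_(i <- s | P i) F i) <= \sum_(i <- s | P i) m (F i))%E.
Proof.
move=> mF; elim: s => [|i s IH]; first by rewrite !big_nil measure0.
rewrite !big_cons; case: ifP => // _.
apply: (le_trans (measureU2 _ _ _)) => //; last exact: leeD2l.
by apply: bigsetU_measurable.
Qed.

(** For sets [E k] chosen with summable bounds, Borel-Cantelli makes the limit
    superior of the [E k] null for [m1] and that of their complements null for
    [m2]; the two together cover the space. *)
Lemma singular_of_small (m1 m2 : {measure set T -> \bar R}) :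
  (forall e : R, 0 < e -> exists E,
    [/\ measurable E, (m1 E <= e%:E)%E & (m2 (~` E) <= e%:E)%E]) ->
  singular m1 m2.
Proof.
move=> H.
have eps k : 0 < 1 / (2 ^ (k + 1))%:R :> R by rewrite divr_gt0// ltr0n expn_gt0.
have [E hE] := choice (fun k => H _ (eps k)).
have mE k : measurable (E k) by case: (hE k).
have null (m : {measure set T -> \bar R}) (F : nat -> set T) :
    (forall k, measurable (F k)) ->
    (forall k, (m (F k) <= (1 / (2 ^ (k + 1))%:R)%:E)%E) ->
    m (lim_sup_set F) = 0%E.
  move=> mF leF; apply: lim_sup_set_cvg0 => //.
  have lim := @cvg_geometric_eseries_half R 1 0.
  apply: (@le_lt_trans _ _ (1 / 2 ^+ 0)%:E); last exact: ltry.
  rewrite -(cvg_lim _ lim)//; apply: lee_nneseries => k _; last exact: leF.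
  by move=> _; exact: measure_ge0.
have mlim (F : nat -> set T) : (forall k, measurable (F k)) ->
    measurable (lim_sup_set F).
  by move=> mF; apply: bigcap_measurable => // n _; apply: bigcup_measurable.
exists (~` lim_sup_set E), (lim_sup_set E); split.
- exact/measurableC/mlim.
- exact: mlim.
- exact: setICl.
- by rewrite setCK; apply: null => // k; case: (hE k).
- have mCE k : measurable (~` E k) by exact: measurableC.
  have n2 : m2 (lim_sup_set (fun k => ~` E k)) = 0%E.
    by apply: null => // k; case: (hE k).
  apply/eqP; rewrite -measure_le0 -n2 le_measure ?inE//.
  + exact/measurableC/mlim.
  + exact: mlim.
  + move=> t nt n _.
    have [//|H'] := pselect ((\bigcup_(j >= n) ~` E j) t).
    exfalso; apply: nt => p _; exists (maxn n p); first exact: leq_maxr.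
    have [//|ne] := pselect (E (maxn n p) t).
    by exfalso; apply: H'; exists (maxn n p) => //; exact: leq_maxl.
Qed.
End Measures.

Section InfSeqMeasure.
Context {R : realType} {X : finType} (X_gt1 : (1 < #|X|)%N).
Let T := borel_infseq X_gt1.

Lemma measurable_cylinder (w : seq X) : measurable (cylinder w : set T).
Proof. by apply: sub_sigma_algebra; exact: open_cylinder. Qed.

Lemma measurable_action (A : automaton X) (g : state A) :
  measurable_fun [set: T] (action g : T -> T).
Proof.
apply: (@measurability _ _ T T setT (action g) (@open (infseq X_gt1)) erefl).
move=> _ [U oU <-].
apply: sub_sigma_algebra; rewrite setTI; apply/open_cylinderP => omega Uo.
have [n nU] := (open_cylinderP U).1 oU _ Uo; exists n.
move=> eta /cylinder_mkseq e; apply: nU; apply/cylinder_mkseq.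
by rewrite !mkseq_action e.
Qed.

(** Two cylinders are nested or disjoint, so together with the empty set they
    form a pi-system; it generates the Borel sets because every open set is a
    countable union of cylinders. *)
Lemma cylinder_measure_eq (m1 m2 : {measure set T -> \bar R}) :
  (m1 setT < +oo)%E -> (forall w, m1 (cylinder w) = m2 (cylinder w)) ->
  forall E, measurable E -> m1 E = m2 E.
Proof.
move=> fin e; pose G : set (set T) := [set set0] `|` range (@cylinder X).
have GT : G setT.
  by right; exists [::] => //; apply/seteqP; split.
apply: (@measure_unique _ R T G (fun=> setT)) => //.
- rewrite eqEsubset; split; last first.
    apply: smallest_sub; first exact: sigma_algebra_measurable.
    move=> _ [->|[w _ <-]]; first exact: measurable0.
    exact: measurable_cylinder.
  apply: smallest_sub; first exact: smallest_sigma_algebra.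
  move=> U oU.
  have -> : U = \bigcup_(w : seq X)
      (if `[< cylinder w `<=` U >] then cylinder w else set0).
    apply/seteqP; split => omega.
      move=> /((open_cylinderP U).1 oU)[n nU]; exists (mkseq omega n) => //.
      by case: asboolP => // _; apply/cylinder_mkseq.
    by move=> [w _]; case: asboolP => // wU /wU.
  apply: (@countable_bigcupT_measurable _ (g_sigma_algebraType G) _ _
    (countableP _)) => w.
  apply: sub_sigma_algebra; case: asboolP => _; first by right; exists w.
  by left.
- move=> _ _ [->|[w _ <-]] [->|[w' _ <-]]; rewrite ?set0I ?setI0; try by left.
  have sub (v v' : seq X) omega : (size v <= size v')%N -> cylinder v omega ->
      cylinder v' omega -> cylinder v' `<=` cylinder v.
    move=> le c c' eta d; rewrite /cylinder /= -[RHS]c.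
    have /(congr1 (take (size v))) :
        mkseq eta (size v') = mkseq omega (size v').
      by rewrite d c'.
    by rewrite /mkseq -!map_take take_iota (minn_idPl le).
  have [->|/set0P[omega [c c']]] := eqVneq (cylinder w `&` cylinder w') set0.
    by left.
  have [le|/ltnW le] := leqP (size w) (size w').
    by rewrite (setIidr (sub _ _ omega le c c')); right; exists w'.
  by rewrite (setIidl (sub _ _ omega le c' c)); right; exists w.
- by apply/seteqP; split => // t _; exists 0%N.
- by move=> _ [->|[w _ <-]] //; rewrite !measure0.
Qed.
End InfSeqMeasure.

(** * Markov measures *)

Section MarkovMeasure.
Context {R : realType} {X : finType} {X_gt1 : (1 < #|X|)%N}.
Variables (L : X -> X -> R) (l : X -> R).

Definition word_weight (w : seq X) : R :=
  if w is x :: w' then l x * transition_weight L x w' else 1.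

Lemma markov_cylinder (mu : probability (borel_infseq X_gt1) R) w :
  markov_measure L l mu -> mu (cylinder w) = (word_weight w)%:E.
Proof.
case: w => [|x w] H; last exact: H.
rewrite -(probability_setT mu); congr (mu _); apply/seteqP; split => //.
Qed.

Context {A : automaton X} (g : state A).
Hypothesis Lst : stochastic L.
Hypothesis lp : probability_vector l.
Hypothesis oi : forall s : state A, injective (output s).

Lemma word_weight_ge0 w : 0 <= word_weight w.
Proof.
by case: w => //= x w; rewrite mulr_ge0 ?transition_weight_ge0//; case: lp.
Qed.

Lemma hellinger_sum_le n e :
  (forall (s : state A) x, affinity L n s x <= e) ->
  \sum_(w <- words n.+1)
    Num.sqrt (word_weight w * word_weight (output_word g w)) <= e.
Proof.
move=> le_e; rewrite sum_words.
have [l0 l1] := lp.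
have e0 : 0 <= e.
  have x : X := enum_val (Ordinal (ltnW X_gt1)).
  exact: le_trans (affinity_ge0 L n g x) (le_e g x).
apply: (@le_trans _ _ (\sum_x Num.sqrt (l x * l (output g x)) * e)).
  apply: ler_sum => x _.
  apply: le_trans (ler_wpM2l (sqrtr_ge0 _) (le_e g x)).
  rewrite -(sum_sqrt_transition_weight Lst) mulr_sumr ler_sum// => w _.
  by rewrite /= mulrACA sqrtrM// mulr_ge0.
rewrite -mulr_suml ler_piMl// sum_sqrtM//.
have -> : \sum_x l (output g x) = 1 by rewrite -l1 [RHS](reindex_inj (@oi g)).
rewrite l1.
rewrite ler_pdivrMr// mul1r -[2]/(1 + 1) gerBl.
by apply: sumr_ge0 => x _; exact: sqr_ge0.
Qed.

(** The set [E] is the union of the cylinders of [output_word g w] over the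
    words [w] whose weight decreases under [g]. On each side the smaller of two
    weights is at most their geometric mean, so both measures are bounded by
    the Hellinger sum. *)
Lemma hellinger_separation (mu : probability (borel_infseq X_gt1) R) n e :
  markov_measure L l mu ->
  (forall (s : state A) x, affinity L n s x <= e) ->
  exists E : set (borel_infseq X_gt1), [/\ measurable E, (mu E <= e%:E)%E &
    (pushforward mu (action g : borel_infseq X_gt1 -> borel_infseq X_gt1) (~` E)
       <= e%:E)%E].
Proof.
move=> hmu le_e; have le_sum := hellinger_sum_le le_e.
pose P w := word_weight (output_word g w) < word_weight w.
pose E : set (borel_infseq X_gt1) :=
  \big[setU/set0]_(w <- words n.+1 | P w) cylinder (output_word g w).
have mc (w : seq X) : measurable (cylinder w : set (borel_infseq X_gt1)).
  exact: measurable_cylinder.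
have small (Q : pred (seq X)) F :
    (forall w, Q w ->
      F w <= Num.sqrt (word_weight w * word_weight (output_word g w))) ->
    (\sum_(w <- words n.+1 | Q w) (F w)%:E <= e%:E)%E.
  move=> FQ; rewrite sumEFin lee_fin; apply: le_trans le_sum.
  rewrite [leRHS](bigID Q) /= -[leLHS]addr0 lerD ?sumr_ge0//.
  by apply: ler_sum => w; exact: FQ.
have sqrt_sqr (a : R) : 0 <= a -> Num.sqrt (a * a) = a.
  by move=> a0; rewrite -expr2 sqrtr_sqr ger0_norm.
exists E; split.
- by apply: bigsetU_measurable => w _; exact: mc.
- apply: (le_trans (measure_bigsetU_le mu _ _ (fun w => mc (output_word g w)))).
  rewrite (eq_bigr (fun w => (word_weight (output_word g w))%:E)); last first.
    by move=> w _; exact: markov_cylinder.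
  apply: small => w /ltW Pw; have w0 := word_weight_ge0 (output_word g w).
  rewrite -{1}(sqrt_sqr _ w0) ler_sqrt ?ler_wpM2r//.
  by rewrite mulr_ge0 ?word_weight_ge0.
- apply: (@le_trans _ _
    (mu (\big[setU/set0]_(w <- words n.+1 | ~~ P w) cylinder w))).
    rewrite /pushforward; apply: le_measure; rewrite ?inE.
    + rewrite -[X in measurable X]setTI; apply: measurable_action => //.
      by apply: measurableC; apply: bigsetU_measurable => w _; exact: mc.
    + by apply: bigsetU_measurable => w _; exact: mc.
    + move=> omega /= nE; rewrite -bigcup_seq_cond.
      exists (mkseq omega n.+1); last by apply/cylinder_mkseq.
      rewrite /= mkseq_words /=; apply/negP => Pw; apply: nE.
      rewrite /E -bigcup_seq_cond; exists (mkseq omega n.+1).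
        by rewrite /= mkseq_words.
      by rewrite -mkseq_action; apply/cylinder_mkseq.
  apply: (le_trans (measure_bigsetU_le mu _ _ mc)).
  rewrite (eq_bigr (fun w => (word_weight w)%:E)); last first.
    by move=> w _; exact: markov_cylinder.
  apply: small => w; rewrite -leNgt => Pw; have w0 := word_weight_ge0 w.
  rewrite -{1}(sqrt_sqr _ w0) ler_sqrt ?ler_wpM2l//.
  by rewrite mulr_ge0 ?word_weight_ge0.
Qed.

Lemma word_weight_output w : preserves_weights L l g ->
  word_weight (output_word g w) = word_weight w.
Proof.
move=> [lg Lg]; case: w => //= x w; rewrite lg; congr (_ * _).
elim: w x (g) => //= y w IH x s; by rewrite Lg IH.
Qed.

Lemma preimage_action_cylinder w :
  exists w', output_word g w' = w /\ action g @^-1` (cylinder w) = cylinder w'.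
Proof.
have [w' [sz e]] := output_word_surj g w oi; exists w'; split => //.
apply/seteqP; split => omega; rewrite /cylinder /= -sz mkseq_action -e.
  by move/(output_word_inj oi); apply; rewrite size_mkseq.
by move=> ->.
Qed.
End MarkovMeasure.

Theorem theorem7p9 (R : realType) (X : finType) (X_gt1 : (1 < #|X|)%N)
    (L : X -> X -> R) (l : X -> R)
    (mu : probability (borel_infseq X_gt1) R)
    (A : automaton X) (g : state A) :
  stochastic L -> irreducible_matrix L ->
  probability_vector l -> stationary L l ->
  markov_measure L l mu ->
  bijective (action g) ->
  reversible A -> L_strongly_connected A L ->
  let g_mu : set (borel_infseq X_gt1) -> \bar R :=
    pushforward mu (action g : borel_infseq X_gt1 -> borel_infseq X_gt1) in
  (~ preserves_weights L l g -> singular mu g_mu) /\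
  (preserves_weights L l g ->
     forall E : set (borel_infseq X_gt1), measurable E -> g_mu E = mu E).
Proof.
move=> Lst _ lp lst hmu gbij rev sc g_mu.
have oi : forall s : state A, injective (output s).
  exact: invertible_output_inj gbij sc.
have mg := @measurable_action X X_gt1 A g.
(* The pushforward is a measure only through the measurability of the action,
   so its measure structure is given explicitly. *)
pose g_mu' : {measure set (borel_infseq X_gt1) -> \bar R} :=
  measure_function_pushforward__canonical__measure_function_Measure mu mg.
split=> [npres|pres].
  have [s [x [y ne]]] : exists (s : state A) x y,
      L (output s x) (output (trans s x) y) != L x y.
    apply: contrapT => H; apply: npres.
    have Leq (s : state A) x y : L (output s x) (output (trans s x) y) = L x y.
      by apply: contrapT => /eqP ne; apply: H; exists s, x, y.
    split=> // x; apply: (stationary_output Lst _ oi rev lp lst Leq) => y z.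
    by have [w [_ p]] := sc g g y z; exists w.
  apply: (@singular_of_small _ _ _ mu g_mu') => e e0.
  have [n le_e] := affinity_cvg0 Lst oi sc ne e0.
  exact: (hellinger_separation g Lst lp oi hmu le_e).
apply: (@cylinder_measure_eq _ _ _ g_mu' mu).
  rewrite /= /pushforward preimage_setT probability_setT; exact: ltry.
move=> w; rewrite /= /pushforward.
have [w' [<- ->]] := preimage_action_cylinder g oi w.
by rewrite !(markov_cylinder _ hmu) word_weight_output.
Qed.
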